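(* For any finite labeled poset $(P,\omega)$, with $\Omega'$ denoting the derivative in $t$, $$\Omega'(P,\omega;t)=\sum_{S\in\mathcal I(P)}\phi(S,\omega)\,\Omega(P\setminus S,\omega;t)=\sum_{S\in\mathcal I(P)}\phi(P\setminus S,\omega)\,\Omega(S,\omega;t),$$ or in other words $$\Omega'(P,\omega;t)=\sum_{S\in\mathcal I(P)}\Omega'(S,\omega;0)\,\Omega(P\setminus S,\omega;t)=\sum_{S\in\mathcal I(P)}\Omega'(P\setminus S,\omega;0)\,\Omega(S,\omega;t).$$
   Context: All posets are finite and $\mathbb N^+=\{1,2,\dots\}$, $[n]=\{1,\dots,n\}$. An ideal of a poset $P$ is a down-closed subset; $\mathcal I(P)$ is the set of all ideals, including $\emptyset$ and $P$. A labeled poset $(P,\omega)$ is a finite poset $P$ with an injective map $\omega:P\to\mathbb N^+$; each subset $S\subseteq P$ carries the induced order and labeling, giving a labeled poset $(S,\omega)$. A subset $S$ is $\omega$-natural if $\omega|_S$ is order-preserving ($\emptyset$ is $\omega$-natural). A map $f:P\to[n]$ is $\omega$-order-preserving if it is order-preserving and $f(x)>f(y)$ whenever $x>y$ in $P$ and $\omega(x)<\omega(y)$. The order polynomial $\Omega(P,\omega;t)$ is the unique polynomial in $t$ whose value at each $n\in\mathbb N^+$ is the number of $\omega$-order-preserving maps $P\to[n]$; $\Omega(\emptyset,\omega;t)=1$. The matrix $A(P,\omega)$ has rows and columns indexed by $\mathcal I(P)$; its $(I,J)$ entry is $1$ if $I\subsetneq J$ and $J\setminus I$ is $\omega$-natural,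 and $0$ otherwise (it is nilpotent). Put $\Phi(P,\omega)=\ln(1+A(P,\omega))=\sum_{n\ge1}\frac{(-1)^{n-1}}{n}A(P,\omega)^n$. The rational number $\phi(P,\omega)$ is the $(\emptyset,P)$ entry of $\Phi(P,\omega)$ (so $\phi(\emptyset,\omega)=0$); it equals the coefficient of $t$ in $\Omega(P,\omega;t)$. *)

(* Defs.v *)
From HB Require Import structures.
From mathcomp Require Import all_boot all_order all_algebra.

Set Implicit Arguments.
Unset Strict Implicit.
Unset Printing Implicit Defensive.

Import Order.TTheory GRing.Theory Num.Theory.

Local Open Scope nat_scope.

(* A labeled poset is a [P : finPOrderType d] together with a label
   [w : P -> nat]; injectivity and positivity of [w] are hypotheses of the
   theorem, as the definitions below do not need them. *)

(* The induced poset on [S]; its labeling is [restrict w S]. *)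
Definition induced d (P : finPOrderType d) (S : {set P}) : Type :=
  {x : P | x \in S}.

HB.instance Definition _ d (P : finPOrderType d) (S : {set P}) :=
  SubFinite.copy (induced S) {x : P | x \in S}.
HB.instance Definition _ d (P : finPOrderType d) (S : {set P}) :=
  [SubChoice_isSubPOrder of induced S by <: with d].

Lemma induced_leE d (P : finPOrderType d) (S : {set P}) (x y : induced S) :
  (x <= y)%O = (val x <= val y)%O.
Proof. by []. Qed.

Definition restrict d (P : finPOrderType d) (w : P -> nat) (S : {set P}) :
  induced S -> nat := fun x => w (val x).
Arguments restrict {d P} w S x.

Section LabeledPoset.

Variables (d : Order.disp_t) (P : finPOrderType d).
Implicit Types (I J S : {set P}) (w : P -> nat).

Definition is_ideal I := [forall y in I, forall x : P, (x <= y)%O ==> (x \in I)].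

Definition ideals : {set {set P}} := [set I | is_ideal I].

Lemma set0_ideal : set0 \in ideals.
Proof. by rewrite inE; apply/forallP=> y; rewrite inE. Qed.

Lemma setT_ideal : [set: P] \in ideals.
Proof.
by rewrite inE; apply/forall_inP=> y _; apply/forallP=> x; rewrite inE implybT.
Qed.

Definition natural w S :=
  [forall x in S, forall y in S, (x <= y)%O ==> (w x <= w y)].

(* ['I_n] = {0, .., n-1} plays the role of [n]. *)
Definition omega_order_preserving w n (f : {ffun P -> 'I_n}) :=
  [forall x : P, forall y : P,
     ((x <= y)%O ==> (f x <= f y)) &&
     ((y < x)%O && (w x < w y) ==> (f y < f x))].

Definition num_op_maps w n :=
  #|[set f : {ffun P -> 'I_n} | omega_order_preserving w f]|.

End LabeledPoset.

Section OrderPolynomial.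

Local Open Scope ring_scope.

Variables (d : Order.disp_t) (P : finPOrderType d) (w : P -> nat).

Let surj k :=
  #|[set g : {ffun P -> 'I_k} |
       omega_order_preserving w g && (g @: setT == setT)]|.

Let enum_val_leq n (K : {set 'I_n}) (i j : 'I_#|K|) :
  (enum_val i <= enum_val j)%N = (i <= j)%N.
Proof.
have lt_mono (a b : 'I_#|K|) : (a < b)%N -> (enum_val a < enum_val b)%N.
  move=> lt_ab; rewrite /enum_val.
  set x0 := enum_default _; rewrite (set_nth_default x0 (enum_default b)) -?cardE //.
  have srt : sorted ltn (map val (enum K)).
    rewrite {1}/enum_mem -enumT (subseq_sorted ltn_trans (s2 := iota 0 n)) //.
      by rewrite -val_enum_ord map_subseq // filter_subseq.
    exact: iota_ltn_sorted.
  have := sorted_ltn_nth ltn_trans 0%N srt a b.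
  rewrite !inE size_map -cardE !ltn_ord => /(_ isT isT lt_ab).
  by rewrite !(nth_map x0) -?cardE.
case: (ltngtP i j) => [/lt_mono/ltnW //|/lt_mono|/val_inj->]; last exact: leqnn.
by rewrite ltnNge => /negbTE.
Qed.

Let card_image n (K : {set 'I_n}) :
  #|[set f : {ffun P -> 'I_n} |
       omega_order_preserving w f && (f @: setT == K)]| = surj #|K|.
Proof.
pose F (g : {ffun P -> 'I_#|K|}) : {ffun P -> 'I_n} := [ffun x => enum_val (g x)].
have Finj : injective F.
  by move=> g h /ffunP eqF; apply/ffunP=> x; have := eqF x; rewrite !ffunE => /enum_val_inj.
have opF g : omega_order_preserving w (F g) = omega_order_preserving w g.
  apply: eq_forallb => x; apply: eq_forallb => y; rewrite !ffunE enum_val_leq.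
  by rewrite (ltnNge (val (enum_val _))) enum_val_leq -ltnNge.
rewrite /surj -(card_imset _ Finj); congr #|pred_of_set _|.
apply/setP=> f; rewrite inE; apply/andP/imsetP.
  case=> opf /eqP imf.
  have fK x : f x \in K by rewrite -imf imset_f.
  pose g := [ffun x => enum_rank_in (fK x) (f x)].
  have def_f : f = F g by apply/ffunP=> x; rewrite !ffunE enum_rankK_in.
  exists g => //; rewrite inE -opF -def_f opf /=.
  apply/eqP/setP=> i; rewrite inE.
  have: enum_val i \in f @: setT by rewrite imf enum_valP.
  case/imsetP=> x _; rewrite def_f ffunE => /enum_val_inj ->.
  by rewrite imset_f.
case=> g; rewrite inE -opF => /andP[opg /eqP img] ->; split=> //.
apply/eqP/setP=> k; apply/imsetP/idP => [[x _ ->]|kK].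
  by rewrite ffunE enum_valP.
have: enum_rank_in kK k \in g @: setT by rewrite img inE.
by case/imsetP=> x _ def_k; exists x; rewrite // ffunE -def_k enum_rankK_in.
Qed.

Let binp k : {poly rat} := (k`!%:R)^-1 *: \prod_(i < k) ('X - i%:R%:P).

Let binpE n k : (binp k).[n%:R] = 'C(n, k)%:R.
Proof.
have fk : k`!%:R != 0 :> rat by rewrite pnatr_eq0 -lt0n fact_gt0.
apply: (mulfI fk); rewrite -natrM mulnC bin_ffact /binp hornerZ mulrA divff //.
rewrite mul1r horner_prod; case: (leqP k n) => [le_kn|lt_nk].
  rewrite ffact_prod natr_prod; apply: eq_bigr => i _.
  by rewrite !hornerE natrB // ltnW // (leq_trans (ltn_ord i)).
rewrite ffact_small // (bigD1 (Ordinal lt_nk)) //=.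
by rewrite !hornerE subrr mul0r.
Qed.

Lemma order_poly_exists :
  {p : {poly rat} | forall n, (0 < n)%N -> p.[n%:R] = (num_op_maps w n)%:R}.
Proof.
exists (\sum_(k < #|P|.+1) (surj k)%:R *: binp k) => n _.
rewrite horner_sum /num_op_maps -sum1_card.
rewrite (partition_big (fun f : {ffun P -> 'I_n} =>
           inord #|f @: setT| : 'I_#|P|.+1) xpredT) //= natr_sum.
apply: eq_bigr => k _; rewrite hornerZ binpE -natrM; congr _%:R.
have im_le (f : {ffun P -> 'I_n}) : (#|f @: setT| < #|P|.+1)%N.
  by rewrite ltnS (leq_trans (leq_imset_card _ _)) // cardsT.
rewrite (partition_big (fun f : {ffun P -> 'I_n} => f @: setT)
          (fun K : {set 'I_n} => #|K| == k)) /=; last first.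
  by move=> f /andP[_ /eqP <-]; apply/eqP/esym/inordK/im_le.
rewrite (eq_bigr (fun=> surj k)); last first.
  move=> K /eqP cK; rewrite -cK -card_image -sum1_card; apply: eq_bigl => f.
  rewrite !inE; case: (f @: setT =P K) => [eK|]; rewrite ?andbF ?andbT //.
  suff -> : inord #|f @: setT| = k by rewrite eqxx andbT.
  by apply: val_inj; rewrite /= inordK // eK cK.
rewrite sum_nat_const mulnC; congr (_ * _)%N.
by rewrite -{1}[n]card_ord -card_draws; apply: eq_card => K; rewrite !inE.
Qed.

Definition order_poly : {poly rat} := sval order_poly_exists.

Lemma order_polyE n :
  (0 < n)%N -> order_poly.[n%:R] = (num_op_maps w n)%:R.
Proof. exact: (svalP order_poly_exists). Qed.

Lemma order_poly_unique (p : {poly rat}) :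
    (forall n, (0 < n)%N -> p.[n%:R] = (num_op_maps w n)%:R) ->
  p = order_poly.
Proof.
move=> pE; apply/eqP; rewrite -subr_eq0; apply/negPn/negP => nz.
pose s : seq rat := [seq i%:R | i <- iota 1 (size (p - order_poly))].
have: (size s < size (p - order_poly)%R)%N.
  apply: max_poly_roots => //.
    apply/allP=> x /mapP[i]; rewrite mem_iota => /andP[i_gt0 _] ->.
    by rewrite /root !hornerE pE // order_polyE // subrr.
  rewrite map_inj_uniq ?iota_uniq // => i j /eqP; rewrite eqr_nat.
  by move/eqP.
by rewrite size_map size_iota ltnn.
Qed.

End OrderPolynomial.

Section LogMatrix.

Local Open Scope ring_scope.

(* ln (1 + A) for nilpotent [A]: the series is cut at the size of the matrix,
   see [ln1p_mxE]. *)
Definition ln1p_mx m (A : 'M[rat]_m) : 'M[rat]_m :=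
  \sum_(1 <= n < m.+1) ((-1) ^+ n.-1 / n%:R) *: A ^+ n.

Lemma ln1p_mxE m (A : 'M[rat]_m) N : A ^+ m = 0 -> (m <= N)%N ->
  ln1p_mx A = \sum_(1 <= n < N.+1) ((-1) ^+ n.-1 / n%:R) *: A ^+ n.
Proof.
move=> Am0 le_mN; rewrite (big_cat_nat (n := m.+1)) //= [X in _ + X]big_nat.
rewrite [X in _ + X]big1 ?addr0 // => n /andP[lt_mn _].
by rewrite -(subnK (ltnW lt_mn)) exprD Am0 mulr0 scaler0.
Qed.

Variables (d : Order.disp_t) (P : finPOrderType d) (w : P -> nat).

(* Enumeration of [ideals P], indexing the rows and columns of the matrices. *)
Definition nth_ideal (i : 'I_#|ideals P|) : {set P} := enum_val i.

Definition ideal_rank (I : {set P}) : 'I_#|ideals P| :=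
  enum_rank_in (set0_ideal P) I.

Lemma ideal_rankK I : I \in ideals P -> nth_ideal (ideal_rank I) = I.
Proof. exact: enum_rankK_in. Qed.

Definition ideal_mx : 'M[rat]_#|ideals P| :=
  \matrix_(i, j) ((nth_ideal i \proper nth_ideal j) &&
                  natural w (nth_ideal j :\: nth_ideal i))%:R.

Lemma ideal_mx_nilp : ideal_mx ^+ #|ideals P| = 0.
Proof.
pose r (i : 'I_#|ideals P|) := #|[set k : 'I_#|ideals P| | nth_ideal k \proper nth_ideal i]|.
have r_lt i : (r i < #|ideals P|)%N.
  rewrite -[X in (_ < X)%N]card_ord -cardsT; apply: proper_card.
  by rewrite properT; apply/negP=> /eqP/setP/(_ i); rewrite !inE properxx.
have r_mono i j : nth_ideal i \proper nth_ideal j -> (r i < r j)%N.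
  move=> lt_ij; apply: proper_card; apply/properP; split.
    by apply/subsetP=> k; rewrite !inE => /proper_trans; apply.
  by exists i; rewrite !inE ?properxx.
have pow n i j : (r j < r i + n)%N -> (ideal_mx ^+ n) i j = 0.
  elim: n i j => [|n IHn] i j.
    by rewrite addn0 expr0 mxE => lt_ji; case: eqP lt_ji => // ->; rewrite ltnn.
  move=> lt_ji; rewrite exprS mxE big1 // => k _; rewrite [ideal_mx i k]mxE.
  case: (boolP (nth_ideal i \proper nth_ideal k)) => [/r_mono lt_ik|]; last by rewrite mul0r.
  by rewrite IHn ?mulr0 // (leq_trans lt_ji) // addnS -addSn leq_add2r.
by apply/matrixP=> i j; rewrite pow ?mxE // ltn_addl.
Qed.

Definition Phi : 'M[rat]_#|ideals P| := ln1p_mx ideal_mx.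

Definition phi : rat :=
  Phi (ideal_rank set0) (ideal_rank setT).

End LogMatrix.

(* Main.v *)
(** Cutting an omega-order-preserving map with values in [m + n] at the ideal
    of points sent to [m] gives the convolution identity
      Omega(P; s + t) = sum_S Omega(S; s) Omega(P \ S; t),
    whose derivative in s (resp. t) at 0 is the formula with Omega'(.; 0).
    The same identity, iterated with n = 1, shows that (1 + A)^n has
    (0, P) entry Omega(P; n); hence Omega(P; t) = sum_k (A^k)_(0, P) binom(t, k),
    and since binom(t, k)'(0) = (-1)^(k - 1) / k, Omega'(P; 0) = phi(P). *)

Require Import Defs.
From mathcomp Require Import all_boot all_order all_algebra ring.

Import GRing.Theory.
Local Open Scope ring_scope.

Set Implicit Arguments.
Unset Strict Implicit.
Unset Printing Implicit Defensive.

(** * Polynomial tools: equality from positive integers, shifts, binomial polynomials *)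

Lemma poly_eq_pos_nat (p q : {poly rat}) :
  (forall n, (0 < n)%N -> p.[n%:R] = q.[n%:R]) -> p = q.
Proof.
move=> pq; apply/eqP; rewrite -subr_eq0; apply/negPn/negP => nz.
pose s : seq rat := [seq i%:R | i <- iota 1 (size (p - q))].
have: (size s < size (p - q)%R)%N.
  apply: max_poly_roots => //.
    apply/allP=> x /mapP[i]; rewrite mem_iota => /andP[i_gt0 _] ->.
    by rewrite /root !hornerE pq // subrr.
  by rewrite map_inj_uniq ?iota_uniq // => i j /eqP; rewrite Num.Theory.eqr_nat => /eqP.
by rewrite size_map size_iota ltnn.
Qed.

(** Reduces a derivative at an arbitrary point to one at 0, the form in which the convolution
    identity is differentiated. *)
Lemma deriv_shift0 (p : {poly rat}) c : (p \Po ('X + c%:P))^`().[0] = p^`().[c].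
Proof. by rewrite deriv_comp !derivE addr0 mulr1 horner_comp !hornerE. Qed.

Definition binom_poly k : {poly rat} :=
  (k`!%:R)^-1 *: \prod_(i < k) ('X - i%:R%:P).

Lemma binom_polyE n k : (binom_poly k).[n%:R] = 'C(n, k)%:R.
Proof.
have fk : k`!%:R != 0 :> rat by rewrite Num.Theory.pnatr_eq0 -lt0n fact_gt0.
apply: (mulfI fk); rewrite -natrM mulnC bin_ffact hornerZ mulrA divff // mul1r.
rewrite horner_prod; case: (leqP k n) => [le_kn|lt_nk].
  rewrite ffact_prod natr_prod; apply: eq_bigr => i _.
  by rewrite !hornerE natrB // ltnW // (leq_trans (ltn_ord i)).
by rewrite ffact_small // (bigD1 (Ordinal lt_nk)) //= !hornerE subrr mul0r.
Qed.

(** The factor ['X] vanishes at 0, so only its own derivative contributes. The resulting values are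
    the coefficients of the series ln(1 + x). *)
Lemma deriv_binom_poly0 k : (binom_poly k.+1)^`().[0] = (-1) ^+ k / k.+1%:R.
Proof.
rewrite /binom_poly derivZ hornerZ big_ord_recl subr0 derivM derivX mul1r.
rewrite hornerD hornerM hornerX mul0r addr0 horner_prod.
(* Once the factor of index 0 is split off, the values at 0 are -1, ..., -k. *)
have -> : \prod_(i < k) ('X - (lift ord0 i)%:R%:P).[0] = (-1) ^+ k * k`!%:R :> rat.
  elim: k => [|k IHk]; first by rewrite big_ord0 mulr1.
  rewrite big_ord_recr /= IHk !hornerE factS natrM exprS /bump /= add1n.
  by ring.
rewrite factS natrM invfM mulrC -mulrA; congr (_ * _).
by rewrite mulrCA mulfV ?mulr1 // Num.Theory.pnatr_eq0 -lt0n fact_gt0.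
Qed.

(** * Invariance of the number of maps under label-preserving isomorphism *)

Section LabeledPosets.

Implicit Types d : Order.disp_t.

Lemma num_op_maps_iso d d' (P : finPOrderType d) (Q : finPOrderType d')
    (w : P -> nat) (v : Q -> nat) (h : Q -> P) n :
    bijective h -> (forall x y, (h x <= h y)%O = (x <= y)%O) ->
    (forall x, w (h x) = v x) ->
  num_op_maps v n = num_op_maps w n.
Proof.
case=> k hK kH h_le h_w.
have h_lt x y : (h x < h y)%O = (x < y)%O.
  by rewrite !Order.POrderTheory.lt_neqAle h_le (can_eq hK).
pose F (f : {ffun P -> 'I_n}) : {ffun Q -> 'I_n} := [ffun x => f (h x)].
have F_inj : injective F.
  move=> f g /ffunP e; apply/ffunP=> x; have := e (k x).
  by rewrite !ffunE kH.
rewrite /num_op_maps -(card_imset _ F_inj); apply: eq_card => f.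
rewrite inE; apply/idP/imsetP => [opf|[g]].
  exists [ffun x => f (k x)]; last by apply/ffunP=> x; rewrite !ffunE hK.
  rewrite inE; apply/forallP=> x; apply/forallP=> y; rewrite !ffunE.
  have := forallP (forallP opf (k x)) (k y).
  by rewrite -h_le -h_lt -!h_w !kH.
rewrite inE => opg ->; apply/forallP=> x; apply/forallP=> y; rewrite !ffunE.
by have := forallP (forallP opg (h x)) (h y); rewrite h_le h_lt !h_w.
Qed.

(** An order embedding is injective by antisymmetry, hence an isomorphism onto its image. This
    identifies nested induced posets with subsets of the ambient one. *)
Lemma num_op_maps_embed d d' (P : finPOrderType d) (Q : finPOrderType d')
    (w : P -> nat) (v : Q -> nat) (S : {set P}) (h : Q -> P) n :
    (forall x y, (h x <= h y)%O = (x <= y)%O) ->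
    (forall x, w (h x) = v x) -> h @: setT = S ->
  num_op_maps v n = num_op_maps (restrict w S) n.
Proof.
move=> h_le h_w imh.
have hS x : h x \in S by rewrite -imh imset_f.
have h_inj : injective h.
  move=> x y e; apply/Order.POrderTheory.le_anti.
  by rewrite -!h_le e Order.POrderTheory.lexx.
pose H x : induced S := Sub (h x) (hS x).
apply: (@num_op_maps_iso _ _ _ _ (restrict w S) v H).
- apply: inj_card_bij; first by move=> x y /(congr1 val) /h_inj.
  by rewrite card_sig -[in leqRHS](cardsT Q) -(card_imset _ h_inj) imh; apply: subset_leq_card.
- by move=> x y; rewrite induced_leE /= h_le.
by move=> x; rewrite /restrict /= h_w.
Qed.

(** * Convolution: cutting a map with values in ['I_(m + n)] at height [m] *)

Section Split.

Variables (d : Order.disp_t) (P : finPOrderType d) (w : P -> nat) (m n : nat).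

Let low (f : {ffun P -> 'I_(m + n)}) := [set x | f x < m]%N.

Section Glue.

Variable S : {set P}.

(** The [match] keeps the membership proof, from which the point of the induced poset is built. *)
Definition glue (g : {ffun induced S -> 'I_m})
    (h : {ffun induced (~: S) -> 'I_n}) : {ffun P -> 'I_(m + n)} :=
  [ffun x => match boolP (x \in S) with
             | AltTrue xS => lshift n (g (Sub x xS))
             | AltFalse xS => rshift m (h (Sub x (etrans (in_setC x S) xS)))
             end].

Lemma glue_in g h (u : induced S) : glue g h (val u) = lshift n (g u).
Proof.
rewrite ffunE; case: {-}_ / boolP => [uS|/negP[]]; last exact: valP.
by congr (lshift _ (g _)); apply: val_inj; rewrite SubK.
Qed.

Lemma glue_out g h (u : induced (~: S)) : glue g h (val u) = rshift m (h u).
Proof.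
rewrite ffunE; case: {-}_ / boolP => [uS|uS].
  by have := valP u; rewrite inE uS.
by congr (rshift _ (h _)); apply: val_inj; rewrite SubK.
Qed.

Lemma low_glue g h : low (glue g h) = S.
Proof.
apply/setP=> x; rewrite inE; case: (boolP (x \in S)) => xS.
  by rewrite (glue_in g h (Sub x xS)) /= ltn_ord.
have xS' : x \in ~: S by rewrite inE.
by rewrite (glue_out g h (Sub x xS')) /= ltnNge leq_addr.
Qed.

Lemma glue_surj f : low f = S -> exists g h, f = glue g h.
Proof.
move=> lowf.
have f_lt x : (f x < m)%N = (x \in S) by rewrite -lowf inE.
have gP (u : induced S) : (f (val u) < m)%N by rewrite f_lt; apply: valP.
have hP (u : induced (~: S)) : (f (val u) - m < n)%N.
  have := valP u; rewrite inE -f_lt -leqNgt => le_m.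
  by rewrite ltn_subLR.
exists [ffun u => Ordinal (gP u)], [ffun u => Ordinal (hP u)].
apply/ffunP=> x; case: (boolP (x \in S)) => xS.
  by rewrite (glue_in _ _ (Sub x xS)) ffunE; apply: val_inj.
have xS' : x \in ~: S by rewrite inE.
rewrite (glue_out _ _ (Sub x xS')) ffunE; apply: val_inj => /=.
by rewrite subnKC //; rewrite leqNgt f_lt.
Qed.

Lemma glue_inj g h g' h' : glue g h = glue g' h' -> g = g' /\ h = h'.
Proof.
move=> e; split; apply/ffunP=> u.
  by apply: (@lshift_inj m n); rewrite -(glue_in g h) -(glue_in g' h') e.
by apply: (@rshift_inj m n); rewrite -(glue_out g h) -(glue_out g' h') e.
Qed.

(** Pairs on one side reduce to [g] or [h]. For mixed pairs, values on [S] lie strictly below those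
    outside, and no point outside the ideal [S] lies below a point of [S], so both conditions
    hold. *)
Lemma glue_op g h : S \in ideals P ->
  omega_order_preserving w (glue g h) =
    omega_order_preserving (restrict w S) g &&
    omega_order_preserving (restrict w (~: S)) h.
Proof.
rewrite inE => /forall_inP idS; apply/idP/andP => [opf|[opg oph]].
  split; apply/forallP=> x; apply/forallP=> y;
    have := forallP (forallP opf (val x)) (val y).
    by rewrite !glue_in.
  by rewrite !glue_out /= leq_add2l ltn_add2l.
apply/forallP=> x; apply/forallP=> y.
case: (boolP (x \in S)) (boolP (y \in S)) => xS [] yS.
- have := forallP (forallP opg (Sub x xS)) (Sub y yS).
  by rewrite -[x]/(val (Sub x xS : induced S)) -[y]/(val (Sub y yS : induced S)) !glue_in.
- have yS' : y \in ~: S by rewrite inE.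
  rewrite (glue_in _ _ (Sub x xS)) (glue_out _ _ (Sub y yS')) /=.
  rewrite (leq_trans (ltnW (ltn_ord _)) (leq_addr _ _)) implybT /=.
  apply/implyP=> /andP[/Order.POrderTheory.ltW le_yx _].
  by have := forallP (idS x xS) y; rewrite le_yx (negPf yS).
- have xS' : x \in ~: S by rewrite inE.
  have nle : ~~ (x <= y)%O.
    by apply/negP=> le_xy; have := forallP (idS y yS) x; rewrite le_xy (negPf xS).
  rewrite (negPf nle) (glue_in _ _ (Sub y yS)) (glue_out _ _ (Sub x xS')) /=.
  by rewrite (leq_trans (ltn_ord _) (leq_addr _ _)) implybT.
have xS' : x \in ~: S by rewrite inE.
have yS' : y \in ~: S by rewrite inE.
have := forallP (forallP oph (Sub x xS')) (Sub y yS').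
rewrite (glue_out _ _ (Sub x xS')) (glue_out _ _ (Sub y yS')) /=.
by rewrite leq_add2l ltn_add2l.
Qed.

End Glue.

Lemma num_op_maps_add :
  num_op_maps w (m + n) =
    (\sum_(S in ideals P)
        num_op_maps (restrict w S) m * num_op_maps (restrict w (~: S)) n)%N.
Proof.
(* Maps are sorted by their set of points of value below [m], which is an ideal by monotonicity. *)
rewrite /num_op_maps -sum1_card (partition_big low (mem (ideals P))) /=; last first.
  move=> f; rewrite inE => opf; rewrite inE.
  apply/forall_inP=> y; rewrite inE => lt_y; apply/forallP=> x; apply/implyP=> le_xy.
  rewrite inE; apply: leq_ltn_trans lt_y.
  by have /andP[/implyP/(_ le_xy)] := forallP (forallP opf x) y.
apply: eq_bigr => S idS.
rewrite -cardsX -(card_in_imset (f := fun gh => glue gh.1 gh.2)).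
  rewrite -sum1_card; apply: eq_bigl => f; rewrite inE.
  apply/andP/imsetP => [[opf /eqP /glue_surj [g [h def_f]]]|[[g h]]].
    by exists (g, h); rewrite // !inE -glue_op // -def_f.
  by rewrite !inE => op ->; rewrite low_glue glue_op.
by move=> [g h] [g' h'] _ _ /glue_inj [/= -> ->].
Qed.

End Split.

(** * Maps into at most one value, and powers of [1 + ideal_mx w] *)

Lemma num_op_maps0 d (P : finPOrderType d) (w : P -> nat) :
  num_op_maps w 0 = (#|P| == 0)%N.
Proof.
rewrite /num_op_maps (eq_card (B := {: {ffun P -> 'I_0}})) => [|f].
  by rewrite card_ffun card_ord; case: #|P| => [|k] //; rewrite exp0n.
by rewrite !inE; apply/forallP=> x; case: (f x).
Qed.

Variables (d : Order.disp_t) (P : finPOrderType d) (w : P -> nat).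
Implicit Types I J : {set P}.

(** The only candidate is the constant map; it satisfies the strictness condition exactly when no
    pair of [S] has its labels reversed. *)
Lemma num_op_maps1 (S : {set P}) : num_op_maps (restrict w S) 1 = natural w S.
Proof.
rewrite /num_op_maps.
have op_nat (f : {ffun induced S -> 'I_1}) :
    omega_order_preserving (restrict w S) f = natural w S.
  apply/idP/idP => [opf|/forall_inP natS].
    apply/forall_inP=> x xS; apply/forall_inP=> y yS; apply/implyP=> le_xy.
    have := forallP (forallP opf (Sub y yS)) (Sub x xS).
    rewrite !ord1 /= ltnn implybF implybT /= negb_and -leqNgt /restrict /=.
    case/orP=> //; rewrite Order.POrderTheory.lt_neqAle induced_leE /= le_xy andbT.
    by rewrite negbK => /eqP/(congr1 val) /= ->.
  apply/forallP=> x; apply/forallP=> y; rewrite !ord1 ltnn implybF implybT /=.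
  apply/negP=> /andP[/Order.POrderTheory.ltW le_yx]; rewrite ltnNge => /negP; apply.
  by have /forall_inP/(_ _ (valP x))/implyP := natS _ (valP y); apply.
case: (boolP (natural w S)) => natS.
  rewrite (eq_card (B := {: {ffun induced S -> 'I_1}})) => [|f].
    by rewrite card_ffun card_ord exp1n.
  by rewrite !inE op_nat.
by apply: eq_card0 => f; rewrite !inE op_nat (negPf natS).
Qed.

Lemma num_op_maps_setT n : num_op_maps w n = num_op_maps (restrict w setT) n.
Proof. by apply: (num_op_maps_embed (h := id)) => //; rewrite imset_id. Qed.

(** This is [num_op_maps_add] for [induced J], moved back to [P]: as [J] is down-closed, ideals of
    [induced J] are the ideals of [P] contained in [J]. *)
Lemma num_op_maps_ideal_add J m n : J \in ideals P ->
  num_op_maps (restrict w J) (m + n) =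
    (\sum_(I in ideals P | I \subset J)
        num_op_maps (restrict w I) m * num_op_maps (restrict w (J :\: I)) n)%N.
Proof.
rewrite inE => /forall_inP idJ; rewrite num_op_maps_add.
pose emb (S : {set induced J}) : {set P} := val @: S.
have sub_emb S : emb S \subset J.
  by apply/subsetP=> _ /imsetP[x _ ->]; apply: valP.
have nested S k :
    num_op_maps (restrict (restrict w J) S) k = num_op_maps (restrict w (emb S)) k.
  apply: (num_op_maps_embed (h := fun x : induced S => val (val x))) => //.
  apply/setP=> x; apply/imsetP/imsetP => [[u _ ->]|[y yS ->]].
    by exists (val u) => //; apply: valP.
  by exists (Sub y yS).
rewrite (reindex_onto emb (fun I => val @^-1: I)) /=; last first.
  move=> I /andP[_ sIJ]; apply/setP=> x; apply/imsetP/idP => [[y]|xI].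
    by rewrite inE => yI ->.
  by exists (Sub x (subsetP sIJ x xI)); rewrite ?inE.
apply: eq_big => [S|S _].
  rewrite sub_emb andbT; have -> : val @^-1: emb S = S.
    by apply/setP=> x; rewrite inE mem_imset //; apply: val_inj.
  rewrite eqxx andbT !inE.
  apply/forall_inP/forall_inP => [idS y /imsetP[v vS ->]|idS v vS].
    apply/forallP=> x; apply/implyP=> le_xv.
    have xJ : x \in J by have := forallP (idJ _ (valP v)) x; rewrite le_xv.
    rewrite -[x]/(val (Sub x xJ : induced J)) imset_f //.
    by have := forallP (idS v vS) (Sub x xJ); rewrite induced_leE /= le_xv.
  apply/forallP=> u; apply/implyP=> le_uv.
  have := forallP (idS (val v) (imset_f _ vS)) (val u).
  by rewrite -induced_leE le_uv mem_imset //; apply: val_inj.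
rewrite !nested; congr (_ * num_op_maps (restrict w _) _)%N.
apply/setP=> x; rewrite inE; apply/imsetP/andP => [[u uS ->]|[xS xJ]].
  by split; [move: uS; rewrite inE mem_imset //; apply: val_inj | apply: valP].
exists (Sub x xJ) => //; rewrite inE; apply: contra xS => xS.
by rewrite -[x]/(val (Sub x xJ : induced J)) imset_f.
Qed.

(** For ideals [I \subset J], the entry of [1 + ideal_mx w] counts the maps from [J :\: I] to one
    point, so multiplying by this matrix is the convolution with second summand 1. *)
Lemma expr_ideal_mx J n : J \in ideals P ->
  ((1 + ideal_mx w) ^+ n) (ideal_rank set0) (ideal_rank J) =
    (num_op_maps (restrict w J) n)%:R.
Proof.
have rank_eq I I' : I \in ideals P -> I' \in ideals P ->
    (ideal_rank I == ideal_rank I') = (I == I').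
  move=> idI idI'; apply/eqP/eqP => [|-> //].
  by move/(congr1 (@nth_ideal _ P)); rewrite !ideal_rankK.
elim: n J => [|n IHn] J idJ.
  rewrite expr0 mxE rank_eq ?set0_ideal // num_op_maps0 card_sig; congr _%:R.
  by rewrite eq_sym -cards_eq0; congr (nat_of_bool (_ == _)); apply: eq_card.
rewrite exprSr mxE -addn1 num_op_maps_ideal_add // natr_sum big_mkcondr /=.
rewrite [RHS]big_enum_val /=; apply: eq_bigr => k _.
have idk : enum_val k \in ideals P := enum_valP k.
have {1 2}-> : k = ideal_rank (enum_val k) by rewrite /ideal_rank enum_valK_in.
rewrite IHn // !mxE rank_eq // !ideal_rankK // num_op_maps1.
case: (boolP (_ \subset J)) => sIJ; last first.
  rewrite properE (negPf sIJ) /= addr0; case: eqP sIJ => [->|_].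
    by rewrite subxx.
  by rewrite mulr0.
(* If the ideal equals [J], the identity matrix supplies the 1 that counts the single map on the
   empty difference; otherwise the entry comes from [ideal_mx w]. *)
rewrite natrM properEneq sIJ andbT; case: eqP => [->|_] /=; last by rewrite add0r.
rewrite addr0 setDv; have -> // : natural w set0.
by apply/forall_inP=> x; rewrite inE.
Qed.

(** * Binomial expansion of the order polynomial and its linear coefficient *)

Lemma order_poly_ideal_mx :
  order_poly w = \sum_(k < #|ideals P|.+1)
    (ideal_mx w ^+ k) (ideal_rank set0) (ideal_rank setT) *: binom_poly k.
Proof.
apply/esym/order_poly_unique => n _.
rewrite num_op_maps_setT -expr_ideal_mx ?setT_ideal // addrC exprD1n summxE.
rewrite horner_sum; set A := ideal_mx w.
set G := fun k => (A ^+ k *+ 'C(n, k)) (ideal_rank set0) (ideal_rank setT).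
transitivity (\sum_(k < #|ideals P|.+1) G k).
  apply: eq_bigr => k _; rewrite hornerZ binom_polyE /G.
  by rewrite -scaler_nat mxE mulrC.
rewrite -!(big_mkord xpredT G).
have big_extend k l : (k <= l)%N -> (forall i, (k <= i)%N -> G i = 0) ->
    \sum_(0 <= i < l) G i = \sum_(0 <= i < k) G i.
  move=> le_kl G0; rewrite (big_cat_nat (n := k)) //= [X in _ + X]big_nat.
  rewrite [X in _ + X]big1 ?addr0 //.
  by move=> i /andP[/G0].
(* Both sums are extended to a common bound: the added terms vanish by nilpotency past
   [#|ideals P|], and by [bin_small] past [n]. *)
rewrite -(@big_extend _ (maxn n #|ideals P|).+1) ?ltnS ?leq_maxr //; last first.
  move=> i lt_i; rewrite /G -(subnK (ltnW lt_i)) exprD ideal_mx_nilp mulr0.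
  by rewrite mul0rn mxE.
rewrite (@big_extend n.+1) ?ltnS ?leq_maxl // => i lt_ni.
by rewrite /G bin_small // mulr0n mxE.
Qed.

Lemma phiE : phi w = (order_poly w)^`().[0].
Proof.
rewrite order_poly_ideal_mx raddf_sum horner_sum big_ord_recl.
(* The term [k = 0] is constant, so the sum starts at 1 like the logarithm series. *)
rewrite /= {1}/binom_poly big_ord0 !derivZ derivC !scaler0 horner0 add0r.
rewrite /phi /Phi /ln1p_mx summxE big_add1 /= big_mkord.
by apply: eq_bigr => k _; rewrite mxE derivZ hornerZ deriv_binom_poly0 mulrC.
Qed.

(** * Addition formulas for order polynomials and their derivatives *)

Lemma order_poly_add n : (0 < n)%N ->
  order_poly w \Po ('X + n%:R%:P) =
    \sum_(S in ideals P)
       (order_poly (restrict w (~: S))).[n%:R] *: order_poly (restrict w S).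
Proof.
(* With the shift [n] fixed, this is an identity in one variable, tested at positive integers [m],
   where [order_polyE] applies. *)
move=> n_gt0; apply: poly_eq_pos_nat => m m_gt0.
rewrite horner_comp !hornerE -natrD order_polyE ?addn_gt0 ?m_gt0 //.
rewrite num_op_maps_add natr_sum horner_sum; apply: eq_bigr => S _.
by rewrite hornerZ !order_polyE // natrM mulrC.
Qed.

(** The summands are swapped before cutting, so that the variable falls on the complement of the
    ideal. *)
Lemma order_poly_addl n : (0 < n)%N ->
  order_poly w \Po ('X + n%:R%:P) =
    \sum_(S in ideals P)
       (order_poly (restrict w S)).[n%:R] *: order_poly (restrict w (~: S)).
Proof.
move=> n_gt0; apply: poly_eq_pos_nat => m m_gt0.
rewrite horner_comp !hornerE -natrD addnC order_polyE ?addn_gt0 ?n_gt0 //.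
rewrite num_op_maps_add natr_sum horner_sum; apply: eq_bigr => S _.
by rewrite hornerZ !order_polyE // natrM.
Qed.

(** The derivative at [n] is that of the shifted polynomial at 0; in [order_poly_add] only the
    factor of the ideal depends on the variable. *)
Lemma deriv_order_poly_low :
  (order_poly w)^`() =
    \sum_(S in ideals P)
      (order_poly (restrict w S))^`().[0] *: order_poly (restrict w (~: S)).
Proof.
apply: poly_eq_pos_nat => n n_gt0.
rewrite -deriv_shift0 order_poly_add // raddf_sum !horner_sum /=.
by apply: eq_bigr => S _; rewrite derivZ !hornerZ mulrC.
Qed.

Lemma deriv_order_poly_high :
  (order_poly w)^`() =
    \sum_(S in ideals P)
      (order_poly (restrict w (~: S)))^`().[0] *: order_poly (restrict w S).
Proof.
apply: poly_eq_pos_nat => n n_gt0.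
rewrite -deriv_shift0 order_poly_addl // raddf_sum !horner_sum /=.
by apply: eq_bigr => S _; rewrite derivZ !hornerZ mulrC.
Qed.

End LabeledPosets.

Theorem proposition2p11 (d : Order.disp_t) (P : finPOrderType d)
    (w : P -> nat) (w_inj : injective w) (w_gt0 : forall x : P, (0 < w x)%N) :
  [/\ (order_poly w)^`() =
        \sum_(S in ideals P)
          phi (restrict w S) *: order_poly (restrict w (~: S)),
      (order_poly w)^`() =
        \sum_(S in ideals P)
          phi (restrict w (~: S)) *: order_poly (restrict w S),
      (order_poly w)^`() =
        \sum_(S in ideals P)
          (order_poly (restrict w S))^`().[0] *:
            order_poly (restrict w (~: S))
    & (order_poly w)^`() =
        \sum_(S in ideals P)
          (order_poly (restrict w (~: S)))^`().[0] *:
            order_poly (restrict w S)].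
Proof.
split; [ | | exact: deriv_order_poly_low | exact: deriv_order_poly_high].
  by rewrite deriv_order_poly_low; apply: eq_bigr => S _; rewrite phiE.
by rewrite deriv_order_poly_high; apply: eq_bigr => S _; rewrite phiE.
Qed.
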